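(* Let $\mathbb{F}$ be a finite field and let $\mathcal{C}\subseteq\mathbb{F}^n$ be a $k$-dimensional linear code such that $\mathcal{C}$ and its dual $\mathcal{C}^{\perp}$ both have support $\mathcal{I}=\{0,\ldots,n-1\}$. Let $(X,\mathcal{T})$ be a characteristic pair of $\mathcal{C}$, where $\mathcal{T}=[(a_l,b_l],\,l=1,\ldots,n]$. Suppose the rows of $X$ with indices $l_1,\ldots,l_k$ are linearly independent and (with their spans from $\mathcal{T}$) give rise to a minimal $\mathrm{KV}$-trellis of $\mathcal{C}$. Then there exists a characteristic matrix $\hat X$ of $\mathcal{C}^{\perp}$ such that the $n-k$ rows of $\hat X$ that do not have (characteristic) spans $(b_{l_i},a_{l_i}]$, $i=1,\ldots,k$, are linearly independent and give rise to a minimal $\mathrm{KV}$-trellis of $\mathcal{C}^{\perp}$.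
   Context: Trellises. A (tail-biting) trellis $T=(V,E)$ of depth $n$ over $\mathbb{F}$ has a vertex set that is the disjoint union $V=V_0\cup\ldots\cup V_{n-1}$ and edge sets $E_i\subseteq V_i\times\mathbb{F}\times V_{i+1}$ for $i\in\mathcal{I}=\{0,\ldots,n-1\}$ (time indices are always taken modulo $n$); $(v,a,w)\in E_i$ is an edge from $v$ to $w$ with label $a$. A cycle is a closed path $v_0\to v_1\to\ldots\to v_{n-1}\to v_0$ of length $n$ with $v_i\in V_i$ and labels $c_0,\ldots,c_{n-1}$. The edge-label code $\mathcal{C}(T)\subseteq\mathbb{F}^n$ is the set of label sequences $(c_0,\ldots,c_{n-1})$ of all cycles; $T$ is a trellis of (represents) $\mathcal{C}$ if $\mathcal{C}(T)=\mathcal{C}$. $T$ is reduced if every vertex and every edge lies on at least one cycle. $T$ is linear if it is reduced, the $V_i$ are $\mathbb{F}$-vector spaces, and the set of all $(v_0,c_0,v_1,c_1,\ldots,v_{n-1},c_{n-1})$ coming from cycles is a subspace of $V_0\times\mathbb{F}\times\ldots\times V_{n-1}\times\mathbb{F}$. Minimality. A linear trellis $T=(V,E)$ of $\mathcal{C}$ is minimal if there is no linear trellis $T'=(V',E')$ of $\mathcal{C}$ such that $|V_i'|\le|V_i|$ for all $i\in\mathcal{I}$ and $|V_j'|<|V_j|$ for some $j\in\mathcal{I}$. Spans. For $a,b\in\mathcal{I}$ put $[a,b]=\{a,\ldots,b\}$ if $a\le b$ and $[a,b]=\{a,\ldots,n-1,0,\ldots,b\}$ if $a>b$, and $(a,b]=[a,b]\setminus\{a\}$.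 The interval $(a,b]$ is a span of a nonzero vector $c\in\mathbb{F}^n$ (coordinates indexed by $\mathcal{I}$) if $c_a\ne0\ne c_b$ and $c_j=0$ for $j\notin[a,b]$ (intervals are recorded by their endpoints $a,b$). The support of a code is the set of coordinates at which some codeword is nonzero. Product trellis. For $G\in\mathbb{F}^{m\times n}$ with columns $G_0,\ldots,G_{n-1}$ and a list $\mathcal{S}=[(a_l,b_l],\,l=1,\ldots,m]$ with $(a_l,b_l]$ a span of the $l$-th row of $G$, let $M_i\in\mathbb{F}^{m\times m}$ be the diagonal matrix whose $l$-th diagonal entry is $1$ if $i\in(a_l,b_l]$ and $0$ otherwise. The product trellis $T_{G,\mathcal{S}}$ has vertex spaces $\{\alpha M_i\mid\alpha\in\mathbb{F}^m\}$ and edge spaces $\{(\alpha M_i,\alpha G_i,\alpha M_{i+1})\mid\alpha\in\mathbb{F}^m\}$, $i\in\mathcal{I}$. If the rows of $G$ form a basis of $\mathcal{C}$, it is a linear trellis representing $\mathcal{C}$. Characteristic pair. A characteristic pair of a $k$-dimensional code $\mathcal{C}\subseteq\mathbb{F}^n$ with support $\mathcal{I}$ is a pair $(X,\mathcal{T})$ where $X\in\mathbb{F}^{n\times n}$ has rows $x_1,\ldots,x_n$ and $\mathcal{T}=[(a_l,b_l],\,l=1,\ldots,n]$ such that: (i) $x_1,\ldots,x_n$ generate $\mathcal{C}$; (ii) $(a_l,b_l]$ is a span of $x_l$ for each $l$; (iii) $a_1,\ldots,a_n$ are distinct and $b_1,\ldots,b_n$ are distinct; (iv) for each $j\in\mathcal{I}$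 there are exactly $n-k$ indices $l$ with $j\in(a_l,b_l]$. Then $X$ is called a characteristic matrix and $\mathcal{T}$ the characteristic span list. A $\mathrm{KV}$-trellis of $\mathcal{C}$ is a product trellis $T_{G,\mathcal{S}}$ where, for some characteristic pair $(X,\mathcal{T})$ of $\mathcal{C}$, $G$ consists of $k$ linearly independent rows of $X$ and $\mathcal{S}$ consists of the corresponding spans from $\mathcal{T}$. Known facts giving meaning to the statement: characteristic pairs exist; the characteristic span list is uniquely determined by the code up to ordering; and if $\mathcal{C}$ and $\mathcal{C}^\perp$ both have support $\mathcal{I}$ and $\mathcal{C}$ has characteristic span list $[(a_l,b_l],\,l=1,\ldots,n]$, then $\mathcal{C}^\perp$ has characteristic span list $[(b_l,a_l],\,l=1,\ldots,n]$. Thus the rows of a characteristic matrix $\hat X$ of $\mathcal{C}^{\perp}$ are indexed by the spans $(b_l,a_l]$, and the selected rows are those whose associated span in the characteristic span list of $\mathcal{C}^\perp$ is not among $(b_{l_1},a_{l_1}],\ldots,(b_{l_k},a_{l_k}]$. *)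

(* Defs.v *)
From HB Require Import structures.
From mathcomp Require Export all_boot all_order all_algebra finfield.

Set Implicit Arguments.
Unset Strict Implicit.
Unset Printing Implicit Defensive.

Import GRing.Theory.
Local Open Scope ring_scope.

(* Linear codes are subspaces [C : {vspace 'rV[F]_n}]; times and coordinates
   are elements of ['I_n], and [ordS] is the successor modulo [n]. *)

Section Codes.
Variables (F : finFieldType) (n : nat).

Definition dual_code (C : {vspace 'rV[F]_n}) : {vspace 'rV[F]_n} :=
  (\bigcap_(c : 'rV[F]_n | c \in C) lker (linfun (mulmxr c^T)))%VS.

Lemma dual_codeP (C : {vspace 'rV[F]_n}) (v : 'rV[F]_n) :
  reflect (forall c, c \in C -> \sum_i v 0 i * c 0 i = 0) (v \in dual_code C).
Proof.
have mulE (c : 'rV[F]_n) : (v *m c^T) 0 0 = \sum_i v 0 i * c 0 i.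
  by rewrite mxE; apply: eq_bigr => i _; rewrite mxE.
have kerE (c : 'rV[F]_n) :
    (v \in lker (linfun (mulmxr c^T))) = (\sum_i v 0 i * c 0 i == 0).
  rewrite memv_ker lfunE /= -mulE; apply/eqP/eqP => [->|vc0]; first by rewrite mxE.
  by apply/matrixP => i j; rewrite !ord1 vc0 mxE.
rewrite /dual_code memvE; apply: (iffP subv_bigcapP) => H c Cc.
  by apply/eqP; rewrite -kerE memvE; exact: H.
by rewrite -memvE kerE (H c Cc).
Qed.

Definition full_support (C : {vspace 'rV[F]_n}) : Prop :=
  forall i : 'I_n, exists2 c : 'rV[F]_n, c \in C & c 0 i != 0.

(* The intervals [a, b] and (a, b], read cyclically. *)
Definition cyc_cc (a b : 'I_n) : {set 'I_n} :=
  if (a <= b)%N then [set j : 'I_n | (a <= j <= b)%N]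
  else [set j : 'I_n | (a <= j)%N || (j <= b)%N].

Definition cyc_oc (a b : 'I_n) : {set 'I_n} := cyc_cc a b :\ a.

(* The pair [s] records the interval (s.1, s.2]. *)
Definition is_span (c : 'rV[F]_n) (s : 'I_n * 'I_n) : Prop :=
  [/\ c 0 s.1 != 0, c 0 s.2 != 0
    & forall j, j \notin cyc_cc s.1 s.2 -> c 0 j = 0].

Definition char_pair (C : {vspace 'rV[F]_n})
    (X : 'M[F]_n) (S : 'I_n -> 'I_n * 'I_n) : Prop :=
  [/\ <<[seq row l X | l <- enum 'I_n]>>%VS = C,
      forall l, is_span (row l X) (S l),
      injective (fun l => (S l).1) /\ injective (fun l => (S l).2)
    & forall j, #|[set l | j \in cyc_oc (S l).1 (S l).2]| = (n - \dim C)%N].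

End Codes.

(* Trellises whose vertex sets are finite vector spaces.  The vertex sets are
   separate types, hence disjoint.  Restricting to finite spaces loses nothing
   for minimality, which only compares a trellis with competitors whose vertex
   sets are at most as large. *)
Record trellis (F : finFieldType) (n : nat) := Trellis {
  vertex : 'I_n -> finLmodType F;
  edges : forall i : 'I_n, {set vertex i * F * vertex (ordS i)}
}.

Section Trellises.
Variables (F : finFieldType) (n : nat).
Implicit Types (T : trellis F n) (C : {vspace 'rV[F]_n}).

Definition is_cycle T (v : forall i, vertex T i) (c : 'rV[F]_n) : Prop :=
  forall i, (v i, c 0 i, v (ordS i)) \in edges T i.

Definition represents T C : Prop :=
  forall c, c \in C <-> exists v, @is_cycle T v c.

Definition reduced T : Prop :=
  (forall i (x : vertex T i), exists v c, @is_cycle T v c /\ v i = x) /\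
  (forall i e, e \in edges T i ->
     exists v c, @is_cycle T v c /\ (v i, c 0 i, v (ordS i)) = e).

Definition linear_trellis T : Prop :=
  [/\ reduced T,
      @is_cycle T (fun=> 0) 0
    & forall (a : F) v c w d, @is_cycle T v c -> @is_cycle T w d ->
        @is_cycle T (fun i => a *: v i + w i) (a *: c + d)].

Definition minimal_trellis C T : Prop :=
  [/\ linear_trellis T, represents T C
    & ~ exists T', [/\ linear_trellis T', represents T' C,
          forall i, (#|vertex T' i| <= #|vertex T i|)%N
        & exists j, (#|vertex T' j| < #|vertex T j|)%N]].

Section Product.
Variables (m : nat) (G : 'M[F]_(m, n)) (S : 'I_m -> 'I_n * 'I_n).

Definition span_mx (i : 'I_n) : 'M[F]_m :=
  diag_mx (\row_l (i \in cyc_oc (S l).1 (S l).2)%:R).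

Definition product_space (i : 'I_n) : {vspace 'rV[F]_m} :=
  limg (linfun (mulmxr (span_mx i))).

Lemma product_spaceP (i : 'I_n) (x : 'rV[F]_m) :
  x \in product_space i <-> exists alpha : 'rV[F]_m, x = alpha *m span_mx i.
Proof.
split=> [/memv_imgP[alpha _ ->]|[alpha ->]]; first by exists alpha; rewrite lfunE.
by apply/memv_imgP; exists alpha; rewrite ?memvf // lfunE.
Qed.

(* [finvect_type] equips a finite-dimensional space over [F] with its
   structure of finite type. *)
Definition product_vertex (i : 'I_n) : finLmodType F :=
  finvect_type (subvs_of (product_space i)).

Definition vertex_val (i : 'I_n) (x : product_vertex i) : 'rV[F]_m :=
  vsval (x : subvs_of (product_space i)).

Definition product_edges (i : 'I_n) :
    {set product_vertex i * F * product_vertex (ordS i)} :=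
  [set e : product_vertex i * F * product_vertex (ordS i) |
    [exists alpha : 'rV[F]_m,
     [&& vertex_val e.1.1 == alpha *m span_mx i,
         e.1.2 == (alpha *m col i G) 0 0
       & vertex_val e.2 == alpha *m span_mx (ordS i)]]].

Definition product_trellis : trellis F n := Trellis product_edges.

End Product.

Definition KV_trellis C T : Prop :=
  exists (X : 'M[F]_n) (S : 'I_n -> 'I_n * 'I_n) (m : nat) (l : 'I_m -> 'I_n),
    [/\ char_pair C X S, m = \dim C, row_free (rowsub l X)
      & T = product_trellis (rowsub l X) (fun i => S (l i))].

Definition minimal_KV_trellis C T : Prop :=
  KV_trellis C T /\ minimal_trellis C T.

End Trellises.

(* Main.v *)
Require Import Defs.
From HB Require Import structures.
From mathcomp Require Import zify.

(* Split the characteristic matrix as X = X0 + X1, where X1 carries the part of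
   each row that has wrapped around past time n - 1.  Up to the order of the
   rows X0 is triangular with nonzero diagonal, and P = - X1 X0^-1 satisfies
   rank P + rank (1 - P) <= (n - k) + k, so P is idempotent.  Therefore
   Y = - X0^-1 P satisfies X Y = 0 and Y X = 0, and the triangular shapes of X0
   and of its counterpart built from the end points of the spans show that
   column l of Y has span (b_l, a_l]: the columns of Y are a characteristic
   matrix of the dual code.  Since ker Y = im X, the columns of Y outside a set
   L are independent as soon as the rows of X in L are a basis of the code.
   Both product trellises have the same state space sizes, and Forney's local
   dual turns any linear trellis of the dual code into one of the code with no
   larger state spaces; hence minimality carries over. *)

Set Implicit Arguments.
Unset Strict Implicit.
Unset Printing Implicit Defensive.

Import GRing.Theory.
Local Open Scope ring_scope.

(** * Linear algebra: ranks, triangular shapes and solvability of systems *)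

Section LinearAlgebra.
Variable F : fieldType.

(** The matrix [E] selects the coordinates in [A]: [E *m E^T] is the identity and the diagonal
    matrix is [E^T *m E], which bounds its rank from both sides. *)
Lemma mxrank_diag_ind m (A : {set 'I_m}) :
  \rank (diag_mx (\row_l (l \in A)%:R) : 'M[F]_m) = #|A|.
Proof.
set D := diag_mx _.
pose E : 'M[F]_(#|A|, m) := \matrix_(h, j) (enum_val h == j)%:R.
have EE : E *m E^T = 1%:M.
  apply/matrixP=> h h'; rewrite !mxE (bigD1 (enum_val h)) //= !mxE eqxx mul1r.
  rewrite big1 ?addr0 => [|j ne]; first by rewrite (inj_eq enum_val_inj) eq_sym.
  by rewrite !mxE eq_sym (negPf ne) mul0r.
have DE : D = E^T *m E.
  apply/matrixP=> i j; rewrite !mxE; have [iA|iNA] := boolP (i \in A).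
    rewrite (bigD1 (enum_rank_in iA i)) //= !mxE enum_rankK_in // eqxx mul1r.
    rewrite big1 ?addr0 => [|h ne]; first by [].
    rewrite !mxE; case: eqP => [eq_i|]; last by rewrite mul0r.
    by move: ne; rewrite -(inj_eq enum_val_inj) enum_rankK_in // eq_i eqxx.
  rewrite mul0rn big1 // => h _; rewrite !mxE; case: eqP => [eq_i|].
    by rewrite -eq_i enum_valP in iNA.
  by rewrite mul0r.
apply/eqP; rewrite eqn_leq; apply/andP; split.
  by rewrite DE (leq_trans (mxrankM_maxr _ _)) // rank_leq_row.
have <- : \rank (E *m (D *m E^T)) = #|A|.
  by rewrite DE !mulmxA EE mul1mx EE mxrank1.
by rewrite (leq_trans (mxrankM_maxr _ _)) // mxrankM_maxl.
Qed.

(** The row spaces of [P] and [1 - P] together span everything, so the rank bound makes their sum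
    direct. As [P] and [1 - P] commute, the rows of their product lie in both. *)
Lemma idempotent_of_rank n (P : 'M[F]_n) :
  (\rank P + \rank (1%:M - P)%R <= n)%N -> P *m P = P.
Proof.
move=> le_n; have sum_n : \rank (P + (1%:M - P)%R)%MS = n.
  have := addmx_sub_adds (submx_refl P) (submx_refl (1%:M - P)).
  rewrite addrC subrK => /mxrankS; rewrite mxrank1 => n_le.
  by apply/eqP; rewrite eqn_leq rank_leq_row.
have cap0 : (P :&: (1%:M - P)%R)%MS = 0.
  by apply/eqP; rewrite -mxrank_eq0 -leqn0 -(leq_add2l n) -{1}sum_n mxrank_sum_cap addn0.
have: ((P *m (1%:M - P))%R <= P :&: (1%:M - P)%R)%MS.
  rewrite sub_capmx submxMl andbT.
  have -> : P *m (1%:M - P) = (1%:M - P) *m P.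
    by rewrite mulmxBl mulmxBr mul1mx mulmx1.
  exact: submxMl.
by rewrite cap0 submx0 mulmxBr mulmx1 subr_eq0 => /eqP.
Qed.

(* [M] is triangular up to the row order [a] and the column order [rho]; the
   last nonzero entry of [y], say at [a l], is seen by row [l] only. *)
Lemma triangular_last n (M : 'M[F]_n) (a : 'I_n -> 'I_n) (rho : 'I_n -> nat)
    (y : 'cV[F]_n) :
    injective a -> injective rho ->
    (forall l, M l (a l) != 0) ->
    (forall l i, (rho i < rho (a l))%N -> M l i = 0) ->
    y != 0 ->
  exists l, [/\ (M *m y) l 0 != 0, y (a l) 0 != 0
              & forall i, (rho (a l) < rho i)%N -> y i 0 = 0].
Proof.
move=> inj_a inj_rho Mdiag Mtri /cV0Pn[i0 yi0].
have [i yi i_max] := arg_maxnP (fun i => rho i) (yi0 : (fun i => y i 0 != 0) i0).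
have y0 j : (rho i < rho j)%N -> y j 0 = 0.
  by move=> lt_ij; apply: contraTeq lt_ij => /i_max; rewrite -leqNgt.
have [a' aK a'K] := injF_bij inj_a.
exists (a' i); rewrite a'K; split=> //.
rewrite mxE (bigD1 i) //= big1 ?addr0 ?mulf_neq0 //; first by rewrite -{2}(a'K i).
move=> j ne_ji; have [lt_ij|] := ltnP (rho i) (rho j); first by rewrite y0 ?mulr0.
rewrite leq_eqVlt (inj_eq inj_rho) (negPf ne_ji) /= => lt_ji.
by rewrite Mtri ?mul0r // a'K.
Qed.

Lemma triangular_unit n (M : 'M[F]_n) (a : 'I_n -> 'I_n) (rho : 'I_n -> nat) :
    injective a -> injective rho ->
    (forall l, M l (a l) != 0) ->
    (forall l i, (rho i < rho (a l))%N -> M l i = 0) ->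
  M \in unitmx.
Proof.
move=> inj_a inj_rho Mdiag Mtri; rewrite -unitmx_tr -row_free_unit.
apply: inj_row_free => v vM0; apply/eqP/negPn/negP; rewrite -trmx_eq0 => v0.
have [l [+ _ _]] := triangular_last inj_a inj_rho Mdiag Mtri v0.
by rewrite -[M]trmxK -trmx_mul vM0 trmx0 mxE eqxx.
Qed.

(** The row supplied by [triangular_last] carries a nonzero entry of [M *m y], and the only such
    entry is in row [l]. *)
Lemma triangular_col n (M : 'M[F]_n) (a : 'I_n -> 'I_n) (rho : 'I_n -> nat)
    (y : 'cV[F]_n) (l : 'I_n) (x : F) :
    injective a -> injective rho ->
    (forall l, M l (a l) != 0) ->
    (forall l i, (rho i < rho (a l))%N -> M l i = 0) ->
    x != 0 -> M *m y = x *: delta_mx l 0 ->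
  y (a l) 0 != 0 /\ forall i, (rho (a l) < rho i)%N -> y i 0 = 0.
Proof.
move=> inj_a inj_rho Mdiag Mtri x0 My.
have y0 : y != 0.
  apply: contraNneq x0 => y0; move: My; rewrite y0 mulmx0 => /matrixP/(_ l 0).
  by rewrite !mxE !eqxx mulr1 => <-.
have [m [+ ym ym0]] := triangular_last inj_a inj_rho Mdiag Mtri y0.
by rewrite My !mxE andbT; case: (m =P l) => [<-|]; rewrite ?mulr0 ?eqxx.
Qed.

(** Fredholm alternative: the right-hand side is attained once every linear relation among the
    equations annihilates it. Arbitrary finite index types allow equations of different kinds in one
    system. *)
Lemma solvable_system (I J : finType) (a : I -> J -> F) (b : I -> F) :
    (forall g : I -> F, (forall j, \sum_i g i * a i j = 0) ->
       \sum_i g i * b i = 0) ->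
  exists s : J -> F, forall i, \sum_j a i j * s j = b i.
Proof.
move=> ortho.
pose M := \matrix_(j < #|J|, i < #|I|) a (enum_val i) (enum_val j).
pose w := \row_(i < #|I|) b (enum_val i).
have /submxP[s sE] : (w <= M)%MS.
  rewrite submxE; apply/eqP/matrixP=> x h; rewrite !ord1 mxE [RHS]mxE.
  pose g (i : I) : F := cokermx M (enum_rank i) h.
  transitivity (\sum_i g i * b i).
    rewrite (reindex (@enum_rank I)) /=; last first.
      by exists enum_val => i _; rewrite ?enum_rankK ?enum_valK.
    by apply: eq_bigr => i _; rewrite mxE enum_rankK mulrC.
  apply: ortho => j; have := congr1 (fun A : 'M_(_, _) => A (enum_rank j) h) (mulmx_coker M).
  rewrite !mxE => eq0; rewrite -[RHS]eq0 [RHS](reindex (@enum_rank I)) /=; last first.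
    by exists enum_val => i _; rewrite ?enum_rankK ?enum_valK.
  by apply: eq_bigr => i _; rewrite mxE !enum_rankK mulrC.
exists (fun j => s 0 (enum_rank j)) => i.
have := congr1 (fun A : 'M_(_, _) => A 0 (enum_rank i)) sE.
rewrite !mxE enum_rankK => ->; rewrite [RHS](reindex (@enum_rank J)) /=; last first.
  by exists enum_val => j _; rewrite ?enum_rankK ?enum_valK.
by apply: eq_bigr => j _; rewrite mxE !enum_rankK mulrC.
Qed.

Lemma sum_delta (I : finType) (i0 : I) (g : I -> F) :
  \sum_i g i * (i0 == i)%:R = g i0.
Proof.
rewrite (bigD1 i0) //= eqxx mulr1 big1 ?addr0 // => i ne.
by rewrite eq_sym (negPf ne) mulr0.
Qed.

Lemma sum_prod (I J : finType) (h : I * J -> F) :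
  \sum_x h x = \sum_i \sum_j h (i, j).
Proof. by rewrite pair_bigA; apply: eq_bigr => -[]. Qed.

End LinearAlgebra.

(** * Trellises built from arbitrary state matrices *)

Section MatrixTrellis.
Variables (F : finFieldType) (n p r : nat).
Variables (G : 'M[F]_(p, n)) (N : 'I_n -> 'M[F]_(p, r)).

(** Arbitrary matrices [N i] in place of [span_mx] cover the product trellises and also the dual
    trellises constructed below. *)
Definition mat_space (i : 'I_n) : {vspace 'rV[F]_r} :=
  limg (linfun (mulmxr (N i))).

Definition mat_vertex (i : 'I_n) : finLmodType F :=
  finvect_type (subvs_of (mat_space i)).

Definition mat_val (i : 'I_n) (x : mat_vertex i) : 'rV[F]_r :=
  vsval (x : subvs_of (mat_space i)).

Definition mat_edges (i : 'I_n) :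
    {set mat_vertex i * F * mat_vertex (ordS i)} :=
  [set e : mat_vertex i * F * mat_vertex (ordS i) |
    [exists alpha : 'rV[F]_p,
     [&& mat_val e.1.1 == alpha *m N i,
         e.1.2 == (alpha *m col i G) 0 0
       & mat_val e.2 == alpha *m N (ordS i)]]].

(* For [N = span_mx S] this is convertible to [product_trellis G S]. *)
Definition mat_trellis : trellis F n := Trellis mat_edges.

Lemma mem_mat_space i (alpha : 'rV_p) : alpha *m N i \in mat_space i.
Proof. by apply/memv_imgP; exists alpha; rewrite ?memvf // lfunE. Qed.

Definition mat_state (alpha : 'rV_p) (i : 'I_n) : mat_vertex i :=
  Subvs (mem_mat_space i alpha).

Lemma mat_stateK alpha i : mat_val (mat_state alpha i) = alpha *m N i.
Proof. by []. Qed.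

Lemma mat_val_inj i : injective (@mat_val i).
Proof. exact: val_inj. Qed.

Lemma mat_valP i (x : mat_vertex i) : exists alpha, x = mat_state alpha i.
Proof.
have /memv_imgP[alpha _] := subvsP (x : subvs_of (mat_space i)).
by rewrite lfunE => xE; exists alpha; apply: mat_val_inj.
Qed.

Lemma mat_col (alpha : 'rV_p) (i : 'I_n) :
  (alpha *m col i G) 0 0 = (alpha *m G) 0 i.
Proof. by rewrite !mxE; apply: eq_bigr => l _; rewrite mxE. Qed.

(** The edges of one cycle may come from different vectors [alpha i] that agree only on the shared
    states; a single [beta] must then induce the same states and labels. *)
Definition locally_closed : Prop := forall alpha : 'I_n -> 'rV[F]_p,
  (forall i, alpha i *m N (ordS i) = alpha (ordS i) *m N (ordS i)) ->
  exists beta, forall i, beta *m N i = alpha i *m N i /\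
    (beta *m G) 0 i = (alpha i *m G) 0 i.

Hypothesis closedN : locally_closed.

Lemma mat_cycleP v c : @is_cycle F n mat_trellis v c <->
  exists alpha, (forall i, v i = mat_state alpha i) /\ c = alpha *m G.
Proof.
split=> [cyc|[alpha [vE ->]] i]; last first.
  rewrite inE; apply/existsP; exists alpha.
  by rewrite /= !vE !mat_stateK mat_col !eqxx.
have /fin_all_exists[alpha alphaP] i : exists alpha : 'rV[F]_p,
    [&& mat_val (v i) == alpha *m N i, c 0 i == (alpha *m G) 0 i
      & mat_val (v (ordS i)) == alpha *m N (ordS i)].
  have := cyc i; rewrite inE => /existsP[alpha].
  by rewrite mat_col => alphaP; exists alpha.
have [i|beta betaP] := closedN (alpha := alpha).
  by have /and3P[_ _ /eqP <-] := alphaP i; have /and3P[/eqP <-] := alphaP (ordS i).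
exists beta; split=> [i|].
  apply: mat_val_inj; rewrite mat_stateK.
  by have /and3P[/eqP -> _ _] := alphaP i; case: (betaP i).
apply/rowP=> i; have /and3P[_ /eqP -> _] := alphaP i.
by case: (betaP i).
Qed.

Lemma mat_trellis_linear : linear_trellis mat_trellis.
Proof.
have cycE alpha : @is_cycle F n mat_trellis (mat_state alpha) (alpha *m G).
  by apply/mat_cycleP; exists alpha.
have state_lin (a : F) (alpha beta : 'rV_p) i :
    mat_state (a *: alpha + beta) i = a *: mat_state alpha i + mat_state beta i.
  by apply: mat_val_inj; rewrite mat_stateK mulmxDl -scalemxAl.
split; first split.
- move=> i x; have [alpha ->] := mat_valP x.
  by exists (mat_state alpha), (alpha *m G).
- move=> i [[x a] y]; rewrite inE => /existsP[alpha /and3P[]] /=.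
  rewrite mat_col => /eqP xE /eqP -> /eqP yE.
  exists (mat_state alpha), (alpha *m G); split=> //.
  by congr (_, _, _); apply: mat_val_inj.
- apply/mat_cycleP; exists 0; rewrite mul0mx; split=> // i.
  by apply: mat_val_inj; rewrite mat_stateK mul0mx.
move=> a v c w d /mat_cycleP[alpha [vE ->]] /mat_cycleP[beta [wE ->]].
apply/mat_cycleP; exists (a *: alpha + beta); split=> [i|].
  by rewrite state_lin vE wE.
by rewrite mulmxDl -scalemxAl.
Qed.

Lemma mat_trellis_represents (C : {vspace 'rV[F]_n}) :
  (forall c, c \in C <-> exists alpha, c = alpha *m G) ->
  represents mat_trellis C.
Proof.
move=> CE c; rewrite CE; split=> [[alpha ->]|[v /mat_cycleP[alpha [_ ->]]]].
  by exists (mat_state alpha); apply/mat_cycleP; exists alpha.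
by exists alpha.
Qed.

End MatrixTrellis.

(** * Linear parametrization of the cycles *)

Section CycleParametrization.
Variables (F : finFieldType) (n : nat) (T : trellis F n).
Local Notation is_cycle := (@is_cycle F n T).
Hypothesis cycle0 : is_cycle (fun=> 0) 0.
Hypothesis cycleD : forall (a : F) v c w d, is_cycle v c -> is_cycle w d ->
  is_cycle (fun i => a *: v i + w i) (a *: c + d).

Lemma cycle_param : exists p (f : forall i, 'rV[F]_p -> vertex T i) (G : 'M_(p, n)),
  (forall i (a : F) x y, f i (a *: x + y) = a *: f i x + f i y) /\
  forall v c, is_cycle v c <-> exists alpha, (forall i, v i = f i alpha) /\ c = alpha *m G.
Proof.
pose A := [set x : {dffun forall i, vertex T i} * 'rV[F]_n |
  [forall i, (x.1 i, x.2 0 i, x.1 (ordS i)) \in edges T i]].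
pose e (h : 'I_#|A|) := enum_val h.
have cyc_e h : is_cycle ((e h).1) ((e h).2).
  by move=> i; have := enum_valP h; rewrite inE => /forallP.
exists #|A|, (fun i alpha => \sum_h alpha 0 h *: (e h).1 i),
  (\matrix_(h, j) (e h).2 0 j); split=> [i a x y|v c].
  rewrite scaler_sumr -big_split; apply: eq_bigr => h _ /=.
  by rewrite !mxE scalerA scalerDl.
split=> [cyc|[alpha [vE ->]]].
  have xA : ([ffun i => v i] : {dffun forall i, vertex T i}, c) \in A.
    by rewrite inE; apply/forallP=> i; rewrite /= !ffunE.
  pose h0 := enum_rank_in xA ([ffun i => v i], c).
  have eh0 : e h0 = ([ffun i => v i], c) by rewrite /e enum_rankK_in.
  exists (delta_mx 0 h0); split=> [i|].
    rewrite (bigD1 h0) //= big1 => [|h ne]; rewrite !mxE !eqxx /=.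
      by rewrite eh0 /= ffunE scale1r addr0.
    by rewrite (negPf ne) scale0r.
  by rewrite -rowE; apply/rowP=> i; rewrite !mxE eh0.
suff: forall s, is_cycle (fun i => \sum_(h <- s) alpha 0 h *: (e h).1 i)
                  (\sum_(h <- s) alpha 0 h *: (e h).2).
  move=> /(_ (index_enum _)) cyc i; rewrite !vE.
  have -> : (alpha *m \matrix_(h, j) (e h).2 0 j) = \sum_h alpha 0 h *: (e h).2.
    by apply/rowP=> j; rewrite !mxE summxE; apply: eq_bigr => h _; rewrite !mxE.
  exact: cyc.
elim=> [i|h s IHs i]; first by rewrite !big_nil; apply: cycle0.
by rewrite !big_cons; apply: (cycleD (alpha 0 h) (cyc_e h) IHs).
Qed.

End CycleParametrization.

(** * Codes as row spaces, and their duals *)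

Section RowCode.
Variables (F : finFieldType) (n : nat).
Implicit Types (v : 'rV[F]_n).

Definition row_code m (M : 'M[F]_(m, n)) : {vspace 'rV[F]_n} :=
  limg (linfun (mulmxr M)).

Lemma mem_row_code m (M : 'M[F]_(m, n)) v : (v \in row_code M) = (v <= M)%MS.
Proof.
apply/memv_imgP/submxP => [[a _]|[a ->]]; first by rewrite lfunE; exists a.
by exists a; rewrite ?memvf // lfunE.
Qed.

Lemma eq_row_code m1 m2 (M1 : 'M[F]_(m1, n)) (M2 : 'M[F]_(m2, n)) :
  (M1 :=: M2)%MS -> row_code M1 = row_code M2.
Proof. by move=> eqM; apply/vspaceP=> v; rewrite !mem_row_code eqM. Qed.

Lemma dim_row_code m (M : 'M[F]_(m, n)) : \dim (row_code M) = \rank M.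
Proof.
rewrite -(eq_row_code (eq_row_base M)) limg_dim_eq; first by rewrite dimvf dim_matrix; exact: mul1n.
apply/eqP; rewrite -subv0; apply/subvP => v /memv_capP[_].
rewrite memv_ker lfunE /= memv0 => /eqP vB0.
by apply/eqP/(row_free_inj (row_base_free M)); rewrite vB0 mul0mx.
Qed.

Lemma span_rows m (M : 'M[F]_(m, n)) :
  <<[seq row l M | l <- enum 'I_m]>>%VS = row_code M.
Proof.
apply/eqP; rewrite eqEsubv; apply/andP; split.
  by apply/span_subvP => _ /mapP[l _ ->]; rewrite mem_row_code row_sub.
apply/subvP => v; rewrite mem_row_code => /submxP[a ->].
rewrite mulmx_sum_row; apply: memv_suml => l _; apply/memvZ/memv_span.
by apply: map_f; rewrite mem_enum.
Qed.

Lemma mem_dual_code v (C : {vspace 'rV[F]_n}) :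
  v \in dual_code C <-> forall c, c \in C -> v *m c^T = 0.
Proof.
have mulE c : (v *m c^T) 0 0 = \sum_i v 0 i * c 0 i.
  by rewrite mxE; apply: eq_bigr => i _; rewrite mxE.
split=> [/dual_codeP vC c Cc|vC].
  by apply/matrixP=> i j; rewrite !ord1 mulE vC // mxE.
by apply/dual_codeP => c /vC vc0; rewrite -mulE vc0 mxE.
Qed.

Lemma dual_row_code m (M : 'M[F]_(m, n)) :
  dual_code (row_code M) = row_code (kermx M^T).
Proof.
apply/vspaceP=> v; rewrite mem_row_code; apply/idP/sub_kermxP.
  move/mem_dual_code=> vM; apply: trmx_inj; apply/row_matrixP=> l.
  rewrite trmx_mul trmxK row_mul trmx0 row0.
  have /vM/(congr1 trmx) : row l M \in row_code M by rewrite mem_row_code row_sub.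
  by rewrite trmx_mul trmxK trmx0.
move=> vM0; apply/mem_dual_code => c; rewrite mem_row_code => /submxP[a ->].
by rewrite trmx_mul mulmxA vM0 mul0mx.
Qed.

Lemma dim_dual_row_code m (M : 'M[F]_(m, n)) :
  \dim (dual_code (row_code M)) = (n - \rank M)%N.
Proof. by rewrite dual_row_code dim_row_code mxrank_ker mxrank_tr. Qed.

Lemma dual_dual_row_code m (M : 'M[F]_(m, n)) :
  dual_code (dual_code (row_code M)) = row_code M.
Proof.
apply/esym/eqP; rewrite eqEdim; apply/andP; split; last first.
  rewrite dual_row_code dim_dual_row_code dim_row_code mxrank_ker mxrank_tr.
  by rewrite subKn // rank_leq_col.
apply/subvP=> c Mc; apply/mem_dual_code => v /mem_dual_code /(_ _ Mc) vc0.
by apply: trmx_inj; rewrite trmx_mul trmxK vc0 trmx0.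
Qed.

End RowCode.

(** * Forney's local dual of a linear trellis *)

Section TrellisDuality.
Variables (F : finFieldType) (n : nat).

Lemma card_mat_vertex p r (N : 'I_n -> 'M[F]_(p, r)) i :
  #|mat_vertex N i| = (#|F| ^ \rank (N i))%N.
Proof.
rewrite -(dim_row_code (N i)) -(card_vspace (row_code (N i))).
rewrite -(card_image (@mat_val_inj _ _ _ _ N i)); apply: eq_card => x.
rewrite mem_row_code; apply/imageP/submxP => [[y _ ->]|[a ->]].
  by have [a ->] := mat_valP y; exists a.
by exists (mat_state N a i).
Qed.

(** The rows of [N] annihilate the kernel of [f], so they are functionals on its image. Composing
    [f] with a right inverse of a row basis of [N] gives an injection into [V]. *)
Lemma card_dual_state p r (V : finLmodType F) (f : 'rV[F]_r -> V) (N : 'M[F]_(p, r)) :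
    (forall (a : F) x y, f (a *: x + y) = a *: f x + f y) ->
    (forall x, f x = 0 -> N *m x^T = 0) ->
  (#|F| ^ \rank N <= #|V|)%N.
Proof.
move=> f_lin fN; pose B := row_base N; pose B' := pinvmx B.
have BB' : B *m B' = 1%:M by rewrite mulmxVp ?row_base_free.
have <- : #|'rV[F]_(\rank N)| = (#|F| ^ \rank N)%N by rewrite card_mx mul1n.
pose g u := f (u *m B'^T); suff inj_g : injective g by rewrite (leq_card _ inj_g).
move=> u w /eqP; rewrite -subr_eq0 => guw; apply/eqP; rewrite -subr_eq0.
have : f ((u - w) *m B'^T) = 0.
  apply/eqP; rewrite mulmxBl addrC -scaleN1r f_lin scaleN1r addrC; exact: guw.
move/fN; rewrite trmx_mul trmxK => NB'.
have : B *m (B' *m (u - w)^T) = 0.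
  have /submxP[K ->] : (B <= N)%MS by rewrite eq_row_base.
  by rewrite -mulmxA NB' mulmx0.
by rewrite mulmxA BB' mul1mx => /(congr1 trmx); rewrite trmxK trmx0 => ->.
Qed.


Lemma linear_mx p r (f : 'rV[F]_p -> 'rV[F]_r) :
    (forall (a : F) x y, f (a *: x + y) = a *: f x + f y) ->
  exists N, forall x, f x = x *m N.
Proof.
move=> f_lin; pose fL := GRing.isLinear.Build F _ _ _ f f_lin.
pose g : {linear 'rV[F]_p -> 'rV[F]_r} := HB.pack f fL.
by exists (lin1_mx g) => x; rewrite mul_rV_lin1.
Qed.

Section LocalDual.
Variables (T : trellis F n) (p : nat) (G : 'M[F]_(p, n)).
Variable f : forall i, 'rV[F]_p -> vertex T i.
Hypothesis f_lin : forall i (a : F) x y, f i (a *: x + y) = a *: f i x + f i y.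
Hypothesis cycleP : forall v c, @is_cycle F n T v c <->
  exists alpha, (forall i, v i = f i alpha) /\ c = alpha *m G.

Let f0 i : f i 0 = 0.
Proof. by have := f_lin i (-1) 0 0; rewrite scaler0 addr0 scaleN1r addNr. Qed.

Let fD i x y : f i (x + y) = f i x + f i y.
Proof. by rewrite -[x]scale1r f_lin !scale1r. Qed.

(* A functional on [vertex T i] is represented by its pullback along [f i],
   a vector of ['rV_p] orthogonal to the kernel of [f i]. *)
Definition local_dual : trellis F n :=
  @Trellis F n (fun=> 'rV[F]_p) (fun i =>
    [set e : 'rV[F]_p * F * 'rV[F]_p |
      (e.2 == e.1.1 + e.1.2 *: (col i G)^T) &&
      [forall x, (f i x == 0) ==> (e.1.1 *m x^T == 0)]]).

Lemma local_dual_cycleP (w : 'I_n -> 'rV[F]_p) (y : 'rV[F]_n) :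
  @is_cycle F n local_dual w y <-> forall i,
    w (ordS i) = w i + y 0 i *: (col i G)^T /\
    forall x, f i x = 0 -> w i *m x^T = 0.
Proof.
split=> cyc i; have := cyc i; rewrite inE /=.
  move=> /andP[/eqP wS /forallP ker]; split=> // x fx0.
  by apply/eqP; have := ker x; rewrite fx0 eqxx.
move=> [-> ker]; rewrite eqxx; apply/forallP => x; apply/implyP => /eqP fx0.
by rewrite ker.
Qed.

(** Pairing a cycle of the local dual with a cycle of [T] gives a telescoping sum. Conversely, a
    word orthogonal to the code makes the linear system for the states solvable, because each
    relation among its equations yields a cycle of [T]. *)
Lemma local_dual_represents (C : {vspace 'rV[F]_n}) :
  represents T C -> represents local_dual (dual_code C).
Proof.
move=> TC y; split=> [yC|[w /local_dual_cycleP cyc]]; last first.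
  apply/dual_codeP => c /TC[v /cycleP[alpha [_ ->]]].
  transitivity (\sum_i ((w (ordS i) *m alpha^T) 0 0 - (w i *m alpha^T) 0 0)).
    apply: eq_bigr => i _; have [-> _] := cyc i.
    rewrite mulmxDl -scalemxAl -trmx_mul [X in _ = X - _]mxE addrAC subrr add0r.
    by rewrite [RHS]mxE [X in _ = _ * X]mxE mat_col.
  by rewrite sumrB [X in _ - X](reindex (@ordS n)) ?subrr //; apply/onW_bij/ordS_bij.
(* The unknowns are the coordinates of all [w i]. The [inl] equations are the edge relations, the
   [inr] equations the orthogonality to vectors of the kernel of [f i]; the indicator makes them
   trivial for vectors outside the kernel. *)
pose I := ('I_n * 'I_p + 'I_n * 'rV[F]_p)%type.
pose a (x : I) (j : 'I_n * 'I_p) : F := match x with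
  | inl il => (j == (ordS il.1, il.2))%:R - (j == il)%:R
  | inr ik => (j.1 == ik.1)%:R * ((f ik.1 ik.2 == 0)%:R * ik.2 0 j.2)
  end.
pose b (x : I) : F := match x with
  | inl il => y 0 il.1 * G il.2 il.1
  | inr _ => 0
  end.
have [g gP|s sP] := @solvable_system F I _ a b.
  rewrite big_sumType /= [X in _ + X]big1 ?addr0 => [|x _]; last by rewrite mulr0.
  (* A relation [g] splits into vectors [alpha i] and corrections [kappa i] in the kernel of [f i];
     its vanishing at every unknown is [alphaS]. *)
  pose alpha i := \row_l g (inl (i, l)).
  pose kappa i := \sum_k (g (inr (i, k)) * (f i k == 0)%:R) *: k.
  have f_kappa i : f i (kappa i) = 0.
    rewrite /kappa; elim: (index_enum _) => [|k r IHr]; first by rewrite big_nil.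
    rewrite big_cons f_lin IHr addr0; case: eqP => [->|_]; first by rewrite scaler0.
    by rewrite mulr0 scale0r.
  have alphaS i : alpha (ordS i) = alpha i + kappa (ordS i).
    apply/rowP => l; have := gP (ordS i, l); rewrite big_sumType /=.
    under eq_bigr do rewrite mulrBr.
    rewrite sumrB sum_delta.
    have eqS (x : 'I_n * 'I_p) : ((ordS i, l) == (ordS x.1, x.2)) = ((i, l) == x).
      by case: x => i1 l1; rewrite /= !xpair_eqE (inj_eq (@ordS_inj n)).
    rewrite [X in X - _](_ : _ = g (inl (i, l))); last first.
      rewrite -[RHS](sum_delta (i, l) (fun x => g (inl x))); apply: eq_bigr => x _.
      by congr (_ * _%:R); rewrite -eqS.
    move=> /eqP; rewrite addrAC subr_eq0 => /eqP eq_l.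
    rewrite !mxE -eq_l; congr (_ + _); rewrite summxE.
    rewrite sum_prod (bigD1 (ordS i)) //= [X in _ + X]big1 ?addr0 => [|j ne]; last first.
      by rewrite big1 // => k _; rewrite eq_sym (negPf ne) mul0r mulr0.
    by apply: eq_bigr => k _; rewrite eqxx mul1r mxE mulrA.
  pose c := \row_i (alpha i *m G) 0 i.
  have /TC Cc : exists v, @is_cycle F n T v c.
    (* Edge [i] is taken from the cycle of [alpha i]; consecutive edges meet because [f (ordS i)]
       kills [kappa (ordS i)]. *)
    exists (fun i => f i (alpha i)) => i.
    have -> : f (ordS i) (alpha (ordS i)) = f (ordS i) (alpha i).
      by rewrite alphaS fD f_kappa addr0.
    rewrite mxE.
    have /(_ i) := (cycleP (fun i' => f i' (alpha i)) (alpha i *m G)).2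
      (ex_intro _ _ (conj (fun=> erefl) erefl)).
    exact.
  rewrite -[RHS](dual_codeP _ _ yC _ Cc) sum_prod.
  apply: eq_bigr => i _; rewrite !mxE mulr_sumr; apply: eq_bigr => l _.
  by rewrite mxE mulrCA.
exists (fun i => \row_l s (i, l)); apply/local_dual_cycleP => i; split=> [|x fx0].
  apply/rowP=> l; rewrite !mxE.
  have := sP (inl (i, l)) => /=.
  under eq_bigr do rewrite mulrC mulrBr ![_ == (_, _)]eq_sym.
  by rewrite sumrB !sum_delta => <-; rewrite addrC subrK.
apply/matrixP=> h h'; rewrite !ord1 [RHS]mxE -[RHS](sP (inr (i, x))) /= mxE.
rewrite sum_prod (bigD1 i) //= [X in _ = _ + X]big1 ?addr0 => [|j ne]; last first.
  by rewrite big1 // => l _; rewrite (negPf ne) !mul0r.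
by apply: eq_bigr => l _; rewrite !mxE eqxx fx0 eqxx !mul1r mulrC.
Qed.

End LocalDual.

(** The local dual has all of ['rV_p] as state spaces, possibly with states on no cycle.
    Parametrizing its cycles and keeping only the states that occur gives a reduced trellis; these
    states annihilate the kernel of [f i], which bounds their number. *)
Lemma dual_trellis (C : {vspace 'rV[F]_n}) (T : trellis F n) :
    linear_trellis T -> represents T C ->
  exists T', [/\ linear_trellis T', represents T' (dual_code C)
               & forall i, (#|vertex T' i| <= #|vertex T i|)%N].
Proof.
move=> [_ cyc0 cycD] TC.
have [p [f [G [f_lin cycleP]]]] := cycle_param cyc0 cycD.
pose D := local_dual G f; have Dcyc := local_dual_cycleP G f.
have [||q [s [Gd [s_lin DcycleP]]]] := @cycle_param F n D.
- apply/Dcyc => i; rewrite mxE scale0r addr0; split=> // x _; exact: mul0mx.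
- move=> a v c w d /Dcyc cycv /Dcyc cycw; apply/Dcyc => i.
  have [vS vker] := cycv i; have [wS wker] := cycw i; split=> [|x fx0].
    by rewrite vS wS !mxE scalerDr scalerDl scalerA addrACA.
  by rewrite mulmxDl -scalemxAl vker // wker // scaler0 addr0.
have /fin_all_exists[N sE] i : exists N, forall x, s i x = x *m N.
  exact: linear_mx (s_lin i).
have cyc_s alpha : @is_cycle F n D (fun i => s i alpha) (alpha *m Gd).
  by apply/DcycleP; exists alpha.
(* Edges of the local dual are given by local conditions, so a closed walk assembled from edges of
   different cycles is again one of its cycles. *)
have closedN : locally_closed Gd N.
  move=> alpha alphaS.
  have : @is_cycle F n D (fun i => alpha i *m N i) (\row_i (alpha i *m Gd) 0 i).
    move=> i; rewrite mxE -alphaS -!sE; exact: cyc_s.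
  case/DcycleP => beta [vE cE]; exists beta => i.
  by rewrite -sE -vE -cE mxE.
exists (mat_trellis Gd N); split; first exact: mat_trellis_linear.
  apply: mat_trellis_represents => // y.
  split=> [/(local_dual_represents f_lin cycleP TC)[w /DcycleP[alpha [_ ->]]]|[alpha ->]].
    by exists alpha.
  by apply/(local_dual_represents f_lin cycleP TC); exists (fun i => s i alpha).
move=> i; rewrite card_mat_vertex; apply: card_dual_state (f_lin i) _ => x fx0.
apply/row_matrixP => l; rewrite row_mul rowE -sE row0.
by have /Dcyc/(_ i)[_] := cyc_s (delta_mx 0 l); apply.
Qed.

End TrellisDuality.

(** * Cyclic intervals *)

Section CyclicIntervals.
Variable n : nat.
Implicit Types a b i j : 'I_n.

Lemma mem_cyc_cc a b j :
  (j \in cyc_cc a b) = if (a <= b)%N then (a <= j <= b)%N else (a <= j)%N || (j <= b)%N.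
Proof. by rewrite /cyc_cc; case: ifP; rewrite inE. Qed.

Lemma mem_cyc_oc a b j : (j \in cyc_oc a b) = (j != a) && (j \in cyc_cc a b).
Proof. by rewrite /cyc_oc !inE. Qed.

Lemma cyc_oc_swap a b : a != b -> cyc_oc b a = ~: cyc_oc a b.
Proof.
move=> ne_ab; apply/setP=> j; rewrite in_setC !mem_cyc_oc !mem_cyc_cc -!(inj_eq val_inj) /=.
move: ne_ab; rewrite -(inj_eq val_inj) /=.
by case: (leqP a b); case: (leqP b a); lia.
Qed.

Lemma ord0_cyc_oc a b (i0 : 'I_n) : i0 = 0%N :> nat -> (i0 \in cyc_oc a b) = (b < a)%N.
Proof.
move=> i00; rewrite mem_cyc_oc mem_cyc_cc -(inj_eq val_inj) /= i00.
by case: (leqP a b); lia.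
Qed.

(** Induction on the cyclic distance [d] from [a], stepping back with [ord_pred]. *)
Lemma cyc_cc_constant (A : Type) (f : 'I_n -> A) a b :
  (forall i, ordS i \in cyc_oc a b -> f (ordS i) = f i) ->
  forall i, i \in cyc_cc a b -> f i = f a.
Proof.
move=> fS i; pose d (j : 'I_n) := (if a <= j then j - a else j + n - a)%N.
have [m] := ubnP (d i); elim: m i => // m IHm i le_d i_ab.
have [->//|ne_ia] := eqVneq i a.
rewrite -(ord_predK i) fS ?ord_predK ?mem_cyc_oc ?ne_ia //.
have := ltn_ord i; have := ltn_ord a; move: ne_ia i_ab le_d.
rewrite -(inj_eq val_inj) mem_cyc_cc /d /= => ne_ia i_ab le_d lt_a lt_i.
have pE : ord_pred i = (if (i : nat) is i'.+1 then i' else n.-1) :> nat.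
  rewrite /=; case: (i : nat) lt_i => [|i'] lt_i; first by rewrite add0n modn_small //; lia.
  by rewrite addSn /= modnDr modn_small //; lia.
apply: IHm; rewrite ?mem_cyc_cc /d pE; move: ne_ia i_ab le_d lt_i;
  case: (i : nat) => [|i']; do ?case: ifP; lia.
Qed.

End CyclicIntervals.

(** * Product trellises: cycles and state space sizes *)

Section ProductTrellis.
Variables (F : finFieldType) (n m : nat).
Variables (G : 'M[F]_(m, n)) (S : 'I_m -> 'I_n * 'I_n).

(** Coordinate [l] of [alpha i] is constant while [i] runs through the closed interval of [S l], so
    the witness reads it at the start point. Outside that interval neither state nor label sees
    it. *)
Lemma product_locally_closed :
  (forall l, is_span (row l G) (S l)) -> locally_closed G (span_mx F S).
Proof.
move=> spanG alpha alphaS; exists (\row_l alpha (S l).1 0 l) => i.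
have spanE (x : 'rV[F]_m) j l :
    (x *m span_mx F S j) 0 l = x 0 l * (j \in cyc_oc (S l).1 (S l).2)%:R.
  by rewrite mul_mx_diag !mxE.
have const l : i \in cyc_cc (S l).1 (S l).2 -> alpha i 0 l = alpha (S l).1 0 l.
  move: i; apply: cyc_cc_constant => i i_oc.
  have /rowP/(_ l) := alphaS i.
  by rewrite !spanE i_oc !mulr1.
split.
  apply/rowP=> l; rewrite !spanE mxE; have [i_oc|] := boolP (_ \in _); last by rewrite !mulr0.
  by rewrite const //; move: i_oc; rewrite mem_cyc_oc => /andP[].
rewrite !mxE; apply: eq_bigr => l _; rewrite mxE.
have [/const ->//|iN] := boolP (i \in cyc_cc (S l).1 (S l).2).
by have [_ _ /(_ _ iN)] := spanG l; rewrite mxE => ->; rewrite !mulr0.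
Qed.

Lemma card_product_vertex i :
  #|vertex (product_trellis G S) i| = (#|F| ^ #|[set l | i \in cyc_oc (S l).1 (S l).2]|)%N.
Proof.
rewrite -[LHS]/(#|mat_vertex (span_mx F S) i|) card_mat_vertex /span_mx.
rewrite -(mxrank_diag_ind F); congr (_ ^ \rank _)%N.
by apply/matrixP=> l l'; rewrite !mxE [in RHS]inE.
Qed.

End ProductTrellis.

(** * Construction of the dual characteristic matrix *)

Section CharacteristicMatrix.
Variables (F : finFieldType) (n : nat) (X : 'M[F]_n) (S : 'I_n -> 'I_n * 'I_n).
Local Notation a l := (S l).1.
Local Notation b l := (S l).2.
Hypotheses (spanX : forall l, is_span (row l X) (S l)).
Hypotheses (inj_a : injective (fun l => a l)) (inj_b : injective (fun l => b l)).
Hypothesis ne_ab : forall l, a l != b l.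
Local Notation W := [set l | (b l < a l)%N].
Hypothesis cardW : #|W| = (n - \rank X)%N.

Lemma dual_char_matrix : exists Y : 'M[F]_n,
  [/\ X *m Y = 0, Y *m X = 0, \rank Y = (n - \rank X)%N
    & forall l, is_span (row l Y^T) (b l, a l)].
Proof.
have Xa l : X l (a l) != 0 by have [+ _ _] := spanX l; rewrite mxE.
have Xb l : X l (b l) != 0 by have [_ + _] := spanX l; rewrite mxE.
have X_out l j : j \notin cyc_cc (a l) (b l) -> X l j = 0.
  by have [_ _ /(_ j)] := spanX l; rewrite mxE.
(* Each row is cut after time [n - 1]: [X0] keeps the columns from [a l] on, [X1] the wrapped part.
   [D] projects onto the wrapping rows, the only ones on which [X1] is nonzero. *)
pose X0 := \matrix_(l, i) (if (a l <= i)%N then X l i else 0).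
pose X1 := \matrix_(l, i) (if (a l <= i)%N then 0 else X l i).
pose D := diag_mx (\row_l (l \in W)%:R) : 'M[F]_n.
have X01 : X0 + X1 = X.
  by apply/matrixP=> l i; rewrite !mxE; case: ifP; rewrite ?addr0 ?add0r.
have DE (M : 'M[F]_n) l i : (D *m M) l i = if l \in W then M l i else 0.
  by rewrite mul_diag_mx !mxE; case: (l \in W); rewrite ?mul1r ?mul0r.
have DX1 : D *m X1 = X1.
  apply/matrixP=> l i; rewrite DE; case: ifPn => //; rewrite inE -leqNgt => le_ab.
  rewrite mxE; case: ifPn => // a_i; rewrite X_out // mem_cyc_cc le_ab.
  by rewrite (negPf a_i).
(* Row [l] of [Z] is the last part of row [l] of [X], the one containing [b l]. *)
pose Z : 'M[F]_n := X1 + (X0 - D *m X0).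
have ZE l i : Z l i = if l \in W then X1 l i else X0 l i.
  rewrite [LHS]mxE [X in _ + X]mxE [X in _ + (_ + X)]mxE DE -{1}DX1 DE.
  by case: (l \in W); rewrite ?subrr ?addr0 // subr0 add0r.
have inj_val : injective (fun i : 'I_n => i : nat) by exact: val_inj.
(* Ordering the columns by [n - i] turns last nonzero entries into first ones, as the end points
   [b l] require. *)
have inj_rev : injective (fun i : 'I_n => n - i)%N.
  move=> i j; have := ltn_ord i; have := ltn_ord j => *; apply: val_inj => /=; lia.
have X0a l : X0 l (a l) != 0 by rewrite mxE leqnn.
have X0tri l (i : 'I_n) : (i < a l)%N -> X0 l i = 0 by rewrite mxE ltnNge => /negPf ->.
have Zb l : Z l (b l) != 0.
  by rewrite ZE !mxE inE; case: (ltnP (b l) (a l)).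
have Ztri l (i : 'I_n) : (n - i < n - b l)%N -> Z l i = 0.
  move=> lt_bi; rewrite ZE !mxE inE; have := ltn_ord i => lt_i.
  have [lt_ba|le_ab] := ltnP (b l) (a l); case: (leqP (a l) i) => // a_i;
    by rewrite X_out // mem_cyc_cc ?le_ab 1?leqNgt ?lt_ba /=; lia.
have X0U : X0 \in unitmx by exact: triangular_unit inj_a inj_val X0a X0tri.
have ZU : Z \in unitmx by exact: triangular_unit inj_b inj_rev Zb Ztri.
pose P := - (X1 *m invmx X0).
have PX0 : P *m X0 = - X1 by rewrite mulNmx mulmxKV.
have XE : X = (1%:M - P) *m X0 by rewrite mulmxBl mul1mx PX0 opprK X01.
have DP : D *m P = P by rewrite mulmxN mulmxA DX1.
have rankD : \rank D = (n - \rank X)%N by rewrite mxrank_diag_ind.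
(* The rank of [P] is at most the number of wrapping rows, while [1 - P] has the rank of [X];
   together they give the bound that makes [P] idempotent. *)
have rankP_le : (\rank P <= n - \rank X)%N by rewrite -rankD -DP mxrankM_maxl.
have rank1P : \rank (1%:M - P) = \rank X.
  by rewrite XE mxrankMfree // row_free_unit.
have PP : P *m P = P.
  apply: idempotent_of_rank; rewrite rank1P.
  by have := rank_leq_row X; move: rankP_le; lia.
have rankP : \rank P = (n - \rank X)%N.
  have := mxrank_add P (1%:M - P); rewrite addrC subrK mxrank1 rank1P.
  by move: rankP_le; lia.
(* By [DP] and equality of ranks, [P] and [D] have the same column space, which the idempotent [P]
   fixes. *)
have PD : P *m D = D.
  have : (D^T <= P^T)%MS.
    rewrite -(geq_leqif (mxrank_leqif_sup _)) ?mxrank_tr ?rankD ?rankP //.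
    by rewrite -DP trmx_mul submxMl.
  by move=> /submxP[Q /(congr1 trmx)]; rewrite trmx_mul !trmxK => ->; rewrite mulmxA PP.
(* Both [X0 *m Y] and [Z *m Y] are [P] up to sign, so both triangular matrices give information on
   the columns of [Y]. *)
pose Y := - (invmx X0 *m P).
have X0Y : X0 *m Y = - P by rewrite mulmxN mulKVmx.
have ZY : Z *m Y = P.
  have DX0 : X0 - D *m X0 = (1%:M - D) *m X0 by rewrite mulmxBl mul1mx.
  rewrite /Z DX0 [LHS]mulmxDl -[_ *m X0 *m Y]mulmxA X0Y mulmxBl mul1mx mulmxN DP subrr addr0.
  by rewrite mulmxN mulmxA -mulNmx PP.
exists Y; split.
- by rewrite XE -mulmxA X0Y mulmxN mulmxBl mul1mx PP subrr oppr0.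
- by rewrite XE mulNmx -mulmxA [P *m _]mulmxA mulmxBr mulmx1 PP subrr mul0mx mulmx0 oppr0.
- rewrite /Y mxrank_opp -rankP eqmxMfull //.
  by rewrite row_full_unit unitmx_inv.
move=> l; have YrowE j : (row l Y^T) 0 j = (col l Y) j 0 by rewrite !mxE.
(* [X0] controls the last nonzero entry of a vector and [Z] the first one.  The
   span is read off [col l Y] itself if [x_l] wraps around, and otherwise off its
   decomposition into [- col l (invmx X0)] and [col l (invmx Z)]. *)
have [lW|lNW] := boolP (l \in W).
  have Pe : P *m delta_mx l 0 = delta_mx l 0 :> 'cV_n.
    have De : D *m delta_mx l 0 = delta_mx l 0 :> 'cV_n.
      apply/colP => i; rewrite mul_diag_mx !mxE.
      by case: (i =P l) => [->|]; rewrite ?lW ?mul1r ?mulr0.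
    by rewrite -De mulmxA PD.
  have Ya : X0 *m col l Y = (-1) *: delta_mx l 0.
    by rewrite colE mulmxA X0Y mulNmx Pe scaleN1r.
  have Yb : Z *m col l Y = 1 *: delta_mx l 0 by rewrite colE mulmxA ZY Pe scale1r.
  have N1 : -1 != 0 :> F by rewrite oppr_eq0 oner_eq0.
  have [Ya0 Ya_out] := triangular_col inj_a inj_val X0a X0tri N1 Ya.
  have [Yb0 Yb_out] := triangular_col inj_b inj_rev Zb Ztri (oner_neq0 _) Yb.
  split; rewrite ?YrowE // => j; rewrite YrowE mem_cyc_cc /=.
  move: lW; rewrite inE => lt_ba; rewrite ltnW // negb_and -!ltnNge.
  by case/orP => [lt_jb|lt_aj]; [apply: Yb_out; have := ltn_ord (b l); lia | apply: Ya_out].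
pose u := - col l (invmx X0); pose w := invmx Z *m delta_mx l 0 : 'cV[F]_n.
(* Here [D] kills the unit vector [l], and [Z *m invmx X0 = 1 - P - D] shows that [Z] maps [u + w]
   to column [l] of [P]. *)
have Yuw : col l Y = u + w.
  apply: (can_inj (mulKmx ZU)); rewrite mulmxDr mulKVmx //.
  rewrite /u !colE mulmxA ZY mulmxN mulmxA.
  have -> : Z *m invmx X0 = - P + 1%:M - D.
    have -> : Z = X1 + (1%:M - D) *m X0 by rewrite mulmxBl mul1mx.
    by rewrite [LHS]mulmxDl mulmxK // opprK addrA.
  have De : D *m delta_mx l 0 = 0 :> 'cV_n.
    apply/colP => i; rewrite mul_diag_mx !mxE.
    by case: (i =P l) => [->|]; rewrite ?(negPf lNW) ?mul0r ?mulr0.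
  by rewrite !mulmxDl !mulNmx De mul1mx subr0 opprD opprK subrK.
have ua : X0 *m u = (-1) *: delta_mx l 0 by rewrite mulmxN colE mulKVmx // scaleN1r.
have wb : Z *m w = 1 *: delta_mx l 0 by rewrite mulKVmx // scale1r.
have N1 : -1 != 0 :> F by rewrite oppr_eq0 oner_eq0.
have [ua0 ua_out] := triangular_col inj_a inj_val X0a X0tri N1 ua.
have [wb0 wb_out] := triangular_col inj_b inj_rev Zb Ztri (oner_neq0 _) wb.
have lt_ab : (a l < b l)%N.
  by move: lNW (ne_ab l); rewrite inE -leqNgt -(inj_eq val_inj) /= ltn_neqAle => -> ->.
have lt_b := ltn_ord (b l).
have YE j : col l Y j 0 = u j 0 + w j 0 by rewrite Yuw [LHS]mxE.
split; rewrite ?YrowE /=.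
- by rewrite YE ua_out ?add0r.
- by rewrite YE wb_out ?addr0 //; lia.
move=> j; rewrite YrowE mem_cyc_cc leqNgt lt_ab /= negb_or -!ltnNge => /andP[lt_jb lt_aj].
by rewrite YE ua_out ?wb_out ?addr0 //; lia.
Qed.

End CharacteristicMatrix.

(** * Complementary rows, and minimality under duality *)

Lemma row_free_rowsub_inj (F : fieldType) n k (X : 'M[F]_n) (l : 'I_k -> 'I_n) :
  row_free (rowsub l X) -> injective l.
Proof.
move=> free_l i j eq_l; have /rowP/(_ i) : delta_mx 0 i = delta_mx 0 j :> 'rV[F]_k.
  by apply: (row_free_inj free_l) => /=; rewrite -!rowE !row_rowsub eq_l.
by rewrite !mxE !eqxx /=; case: eqP => // _ /eqP; rewrite oner_eq0.
Qed.

(* The column kernel of [Y] is the column space of [X], and a vector [X *m u]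
   that vanishes on a set of rows spanning the row space of [X] is zero. *)
Lemma row_free_complement (F : fieldType) n k m (X Y : 'M[F]_n)
    (l : 'I_k -> 'I_n) (l' : 'I_m -> 'I_n) :
    Y *m X = 0 -> \rank Y = (n - \rank X)%N -> \rank (rowsub l X) = \rank X ->
    injective l' -> (forall i h, l i != l' h) ->
  row_free (rowsub l' Y^T).
Proof.
move=> YX rankY rank_l inj_l' disj; apply: inj_row_free => v vY0.
pose c := v *m rowsub l' 1%:M.
have cE j : c 0 j = \sum_h v 0 h * (l' h == j)%:R.
  by rewrite mxE; apply: eq_bigr => h _; rewrite !mxE.
have : (c <= X^T)%MS.
  have XY : X^T *m Y^T = 0 by rewrite -trmx_mul YX trmx0.
  have eq_ker : (X^T == kermx Y^T)%MS.
    rewrite -(geq_leqif (mxrank_leqif_eq _)); last exact/sub_kermxP.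
    by rewrite mxrank_ker !mxrank_tr rankY subKn // rank_leq_row.
  rewrite (eqmxP eq_ker); apply/sub_kermxP.
  by rewrite -mulmxA mul_rowsub_mx mul1mx.
case/submxP => u cu; have /submxP[K XK] : (X <= rowsub l X)%MS.
  by rewrite -(geq_leqif (mxrank_leqif_sup _)) ?rank_l // rowsub_sub.
have c0 : c = 0.
  rewrite cu XK trmx_mul mulmxA.
  suff -> : u *m (rowsub l X)^T = 0 by rewrite mul0mx.
  apply/rowP=> i; transitivity (c 0 (l i)).
    by rewrite cu !mxE; apply: eq_bigr => j _; rewrite !mxE.
  by rewrite cE mxE big1 // => h _; rewrite eq_sym (negPf (disj _ _)) mulr0.
apply/rowP=> h; rewrite mxE -[LHS](sum_delta h (fun h => v 0 h)).
transitivity (c 0 (l' h)); last by rewrite c0 mxE.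
by rewrite cE; apply: eq_bigr => h' _; rewrite (inj_eq inj_l') eq_sym.
Qed.

Lemma product_trellis_linear_represents (F : finFieldType) n m
    (G : 'M[F]_(m, n)) (S : 'I_m -> 'I_n * 'I_n) :
    (forall l, is_span (row l G) (S l)) ->
  linear_trellis (product_trellis G S) /\
  represents (product_trellis G S) (row_code G).
Proof.
move=> /product_locally_closed closedG; split.
  exact: (mat_trellis_linear closedG).
apply: (mat_trellis_represents closedG) => c; rewrite mem_row_code.
by split=> [/submxP|cG]; last exact/submxP.
Qed.

(* Dualizing a competitor of [Td] gives a competitor of [T]. *)
Lemma minimal_trellis_dual (F : finFieldType) n (C : {vspace 'rV[F]_n})
    (T Td : trellis F n) :
    minimal_trellis C T -> dual_code (dual_code C) = C ->
    linear_trellis Td -> represents Td (dual_code C) ->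
    (forall i, #|vertex Td i| = #|vertex T i|) ->
  minimal_trellis (dual_code C) Td.
Proof.
move=> [_ _ minT] CE linTd repTd cardT; split=> // -[T' [linT' repT' leT' [j ltT']]].
have [T2 [linT2 + leT2]] := dual_trellis linT' repT'; rewrite CE => repT2.
apply: minT; exists T2; split=> // [i|].
  by rewrite -cardT; apply: leq_trans (leT2 i) (leT' i).
by exists j; rewrite -cardT; apply: leq_ltn_trans (leT2 j) ltT'.
Qed.

(** * From a characteristic pair of the code to one of its dual *)

Section DualCharacteristicPair.
Variables (F : finFieldType) (n : nat) (C : {vspace 'rV[F]_n}).
Variables (X : 'M[F]_n) (S : 'I_n -> 'I_n * 'I_n).
Hypothesis charXS : char_pair C X S.

Lemma char_pair_row_code : C = row_code X.
Proof. by case: charXS => <- _ _ _; rewrite span_rows. Qed.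

(** If the end points coincided, row [l] would be a nonzero multiple of a unit vector, and every
    dual codeword would vanish at that coordinate. *)
Lemma char_span_neq : full_support (dual_code C) -> forall l, (S l).1 != (S l).2.
Proof.
move=> suppD l; apply/eqP => eq_ab; have [c /dual_codeP cC ca0] := suppD (S l).1.
have [_ /(_ l)[Xa _ X_out] _ _] := charXS.
have Cl : row l X \in C by rewrite char_pair_row_code mem_row_code row_sub.
have := cC _ Cl; rewrite (bigD1 (S l).1) //= big1 ?addr0 => [/eqP|j ne].
  by rewrite mulf_eq0 (negPf ca0) (negPf Xa).
rewrite X_out ?mulr0 // -eq_ab mem_cyc_cc leqnn.
by move: ne; rewrite -(inj_eq val_inj) /=; lia.
Qed.

(** This is the counting condition at time 0, since [(a, b]] contains 0 exactly when it wraps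
    around; for [n = 0] both sides vanish. *)
Lemma card_wrapping_spans :
  #|[set l | ((S l).2 < (S l).1)%N]| = (n - \rank X)%N.
Proof.
have [_ _ _ cnt] := charXS; have [n0|n_gt0] := posnP n.
  rewrite [RHS](_ : _ = 0%N); last by rewrite [X in (X - _)%N]n0.
  by apply/eqP; rewrite -leqn0; apply: leq_trans (max_card _) _; rewrite card_ord n0.
rewrite -dim_row_code -char_pair_row_code -(cnt (Ordinal n_gt0)).
by apply: eq_card => l; rewrite inE [RHS]inE (@ord0_cyc_oc _ _ _ (Ordinal n_gt0)).
Qed.

(** The columns of [Y] lie in the dual code by [X *m Y = 0] and generate it by their rank. Reversed
    spans are complements of the original ones, so exactly [\dim C] of them contain [j]. *)
Lemma dual_char_pair (Y : 'M[F]_n) :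
    (forall l, (S l).1 != (S l).2) ->
    X *m Y = 0 -> \rank Y = (n - \rank X)%N ->
    (forall l, is_span (row l Y^T) ((S l).2, (S l).1)) ->
  char_pair (dual_code C) Y^T (fun l => ((S l).2, (S l).1)).
Proof.
move=> ne_ab XY rankY spanY; have [_ _ [inj_a inj_b] cnt] := charXS.
split=> // [|j]; rewrite char_pair_row_code.
  rewrite span_rows; apply/eqP; rewrite eqEdim dim_dual_row_code.
  rewrite dim_row_code mxrank_tr rankY leqnn andbT dual_row_code.
  apply/subvP => c; rewrite !mem_row_code => /submx_trans; apply.
  by apply/sub_kermxP; rewrite -trmx_mul XY trmx0.
rewrite dim_dual_row_code -dim_row_code -char_pair_row_code -(cnt j).
rewrite -[X in (X - _)%N]card_ord -cardsT -cardsDS ?subsetT //.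
apply: eq_card => l; rewrite in_setD in_setT andbT [LHS]in_set [X in ~~ X]in_set /=.
by rewrite cyc_oc_swap // in_setC.
Qed.

End DualCharacteristicPair.

(** Let [A] be the rows active at time [i] and [L] the chosen rows. Both [A] and [~: L] have [n - k]
    elements, and removing their common part [A :\: L] leaves the two sets to be compared. *)
Lemma card_complement_spans (F : finFieldType) n k m (C : {vspace 'rV[F]_n})
    (X : 'M[F]_n) (S : 'I_n -> 'I_n * 'I_n) (l : 'I_k -> 'I_n) (l' : 'I_m -> 'I_n) i :
    char_pair C X S -> \dim C = k -> (forall l, (S l).1 != (S l).2) ->
    injective l -> injective l' -> (forall j, (j \in codom l') = (j \notin codom l)) ->
  #|[set h | i \in cyc_oc (S (l' h)).2 (S (l' h)).1]| =
  #|[set h | i \in cyc_oc (S (l h)).1 (S (l h)).2]|.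
Proof.
move=> [_ _ _ /(_ i) cnt] dimC ne_ab inj_l inj_l' codom_l'.
set A := [set j | _] in cnt.
have inA j : (j \in A) = (i \in cyc_oc (S j).1 (S j).2) by rewrite in_set.
pose L := [set l h | h : 'I_k].
have cardL : #|L| = k by rewrite card_imset // card_ord.
have -> : #|[set h | i \in cyc_oc (S (l h)).1 (S (l h)).2]| = #|A :&: L|.
  rewrite -(card_imset _ inj_l); apply: eq_card => j; rewrite inE.
  apply/imsetP/andP => [[h + ->]|[jA /imsetP[h _ jE]]].
    by rewrite inE => hA; rewrite inE hA imset_f.
  by exists h; rewrite // inE; move: jA; rewrite inE jE.
have -> : #|[set h | i \in cyc_oc (S (l' h)).2 (S (l' h)).1]| = #|~: L :\: A|.
  rewrite -(card_imset _ inj_l'); apply: eq_card => j; rewrite in_setD in_setC.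
  have -> : (j \in L) = (j \in codom l).
    by apply/imsetP/codomP => [[h _ ->]|[h ->]]; exists h.
  rewrite -codom_l' andbC; apply/imsetP/andP => [[h + ->]|[/codomP[h ->] jA]].
    by rewrite codom_f inA in_set cyc_oc_swap // in_setC.
  by exists h; rewrite // in_set cyc_oc_swap // in_setC -inA.
have := cardsID L A; have := cardsID A (~: L); have := cardsC L.
rewrite card_ord cardL cnt dimC setIC -setDE; lia.
Qed.

(** * Minimality for the rows complementary to the chosen ones *)

Theorem theorem5p3 (F : finFieldType) (n k : nat) (C : {vspace 'rV[F]_n})
    (dimC : \dim C = k)
    (suppC : full_support C) (suppD : full_support (dual_code C))
    (X : 'M[F]_n) (S : 'I_n -> 'I_n * 'I_n) (charXS : char_pair C X S)
    (l : 'I_k -> 'I_n) (freeX : row_free (rowsub l X))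
    (minX : minimal_KV_trellis C
              (product_trellis (rowsub l X) (fun i => S (l i)))) :
  exists (Xd : 'M[F]_n) (Sd : 'I_n -> 'I_n * 'I_n),
    char_pair (dual_code C) Xd Sd /\
    let J := [set j : 'I_n | [forall i : 'I_k,
                Sd j != ((S (l i)).2, (S (l i)).1)]] in
    let ld := fun h : 'I_#|J| => enum_val h in
    [/\ #|J| = (n - k)%N,
        row_free (rowsub ld Xd)
      & minimal_KV_trellis (dual_code C)
          (product_trellis (rowsub ld Xd) (fun h => Sd (ld h)))].
Proof.
have [_ spanX [inj_a inj_b] _] := charXS; have CE := char_pair_row_code charXS.
have rankX : \rank X = k by rewrite -dim_row_code -CE.
have ne_ab := char_span_neq charXS suppD.
have [Y [XY YX rankY spanY]] :=
  dual_char_matrix spanX inj_a inj_b ne_ab (card_wrapping_spans charXS).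
have charY := dual_char_pair charXS ne_ab XY rankY spanY.
exists Y^T, (fun j => ((S j).2, (S j).1)); split=> // J ld.
have inj_l := row_free_rowsub_inj freeX.
have inj_ld : injective ld by exact: enum_val_inj.
(* Start points are distinct, so a reversed span determines its row and [J] is the complement of the
   chosen rows. *)
have mem_J j : (j \in J) = (j \notin codom l).
  rewrite inE; apply/forallP/negP => [neq /codomP[i jE]|jN i].
    by have := neq i; rewrite jE eqxx.
  by apply/negP => /eqP[_ /inj_a jE]; apply: jN; rewrite jE codom_f.
have codom_ld j : (j \in codom ld) = (j \notin codom l).
  rewrite -mem_J; apply/codomP/idP => [[h ->]|jJ]; first exact: enum_valP.
  by exists (enum_rank_in jJ j); rewrite /ld enum_rankK_in.
have cardJ : #|J| = (n - k)%N.
  have := cardC (mem (codom l)); rewrite card_codom // !card_ord.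
  by move/(canRL (addKn k)) => <-; apply: eq_card => j; rewrite mem_J.
have freeY : row_free (rowsub ld Y^T).
  apply: (row_free_complement (l := l) YX rankY) => // [|i h].
    by rewrite rankX; apply/eqP.
  by apply/eqP => lE; have := codom_ld (l i); rewrite {1}lE !codom_f.
have dimD : \dim (dual_code C) = (n - k)%N by rewrite CE dim_dual_row_code rankX.
(* The [n - k] independent rows generate the dual code for reasons of dimension. *)
have DE : row_code (rowsub ld Y^T) = dual_code C.
  apply/eqP; rewrite eqEdim dimD dim_row_code (eqP freeY) [X in (_ <= X)%N]cardJ leqnn andbT.
  have [<- _ _ _] := charY; rewrite span_rows.
  by apply/subvP => c; rewrite !mem_row_code => /submx_trans; apply; apply: rowsub_sub.
have [] := product_trellis_linear_represents (G := rowsub ld Y^T)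
  (S := fun h => ((S (ld h)).2, (S (ld h)).1)).
  by move=> h; rewrite row_rowsub.
rewrite DE => lin_d rep_d.
split=> //; split; first by exists Y^T, (fun j => ((S j).2, (S j).1)), #|J|, ld; rewrite dimD.
have [_ minT] := minX; apply: (minimal_trellis_dual minT) => // [|i].
  by rewrite CE dual_dual_row_code.
by rewrite !card_product_vertex (card_complement_spans i charXS dimC ne_ab inj_l inj_ld codom_ld).
Qed.
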